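(* There exists a polynomial that is convex but not sos-convex. In particular, the trivariate form of degree $8$ in $\mathbb{R}[x_1,x_2,x_3]$ given by $$\begin{aligned} p(x)={}&32x_1^8+118x_1^6x_2^2+40x_1^6x_3^2+25x_1^4x_2^4-43x_1^4x_2^2x_3^2-35x_1^4x_3^4+3x_1^2x_2^4x_3^2\\ &-16x_1^2x_2^2x_3^4+24x_1^2x_3^6+16x_2^8+44x_2^6x_3^2+70x_2^4x_3^4+60x_2^2x_3^6+30x_3^8 \end{aligned}$$ is convex (as a function on $\mathbb{R}^3$) but not sos-convex.
   Context: A form is a polynomial all of whose monomials have the same degree. A symmetric polynomial matrix $P(x)\in\mathbb{R}[x]^{m\times m}$, $x\in\mathbb{R}^n$, is called an sos-matrix if there exist $s\in\mathbb{N}$ and a polynomial matrix $M(x)\in\mathbb{R}[x]^{s\times m}$ such that $P(x)=M^{T}(x)M(x)$. A polynomial $p\in\mathbb{R}[x_1,\ldots,x_n]$ is called sos-convex if its Hessian $H(x)=\left(\frac{\partial^2 p}{\partial x_i\,\partial x_j}\right)_{i,j=1}^{n}$ is an sos-matrix. *)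

(* Defs.v *)
From mathcomp Require Import all_boot all_order all_algebra.
From mathcomp Require Import classical_sets reals convex.
From mathcomp Require Import mpoly.

Set Implicit Arguments.
Unset Strict Implicit.
Unset Printing Implicit Defensive.

Import GRing.Theory.

Local Open Scope ring_scope.

Definition sos_matrix (R : comNzRingType) (n m : nat)
    (P : 'M[{mpoly R[n]}]_m) : Prop :=
  P^T = P /\ exists (s : nat) (M : 'M[{mpoly R[n]}]_(s, m)), P = M^T *m M.

Definition hessian (R : comNzRingType) (n : nat) (p : {mpoly R[n]}) :
    'M[{mpoly R[n]}]_n :=
  \matrix_(i, j) (p^`M(j))^`M(i).

Definition sos_convex (R : comNzRingType) (n : nat) (p : {mpoly R[n]}) : Prop :=
  sos_matrix (hessian p).

Definition convex_poly (R : realType) (n : nat) (p : {mpoly R[n]}) : Prop :=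
  convex_function [set: 'rV[R]_n]%classic (fun x : 'rV[R]_n => p.@[x 0]).

Definition octic_form (R : comNzRingType) : {mpoly R[3]} :=
  let x1 : {mpoly R[3]} := 'X_(inord 0) in
  let x2 : {mpoly R[3]} := 'X_(inord 1) in
  let x3 : {mpoly R[3]} := 'X_(inord 2) in
    32%:R * x1 ^+ 8 + 118%:R * x1 ^+ 6 * x2 ^+ 2
  + 40%:R * x1 ^+ 6 * x3 ^+ 2 + 25%:R * x1 ^+ 4 * x2 ^+ 4
  - 43%:R * x1 ^+ 4 * x2 ^+ 2 * x3 ^+ 2 - 35%:R * x1 ^+ 4 * x3 ^+ 4
  + 3%:R * x1 ^+ 2 * x2 ^+ 4 * x3 ^+ 2 - 16%:R * x1 ^+ 2 * x2 ^+ 2 * x3 ^+ 4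
  + 24%:R * x1 ^+ 2 * x3 ^+ 6 + 16%:R * x2 ^+ 8
  + 44%:R * x2 ^+ 6 * x3 ^+ 2 + 70%:R * x2 ^+ 4 * x3 ^+ 4
  + 60%:R * x2 ^+ 2 * x3 ^+ 6 + 30%:R * x3 ^+ 8.

(* Main.v *)
Require Import Defs.
From HB Require Import structures.
From mathcomp Require Import all_boot all_order all_algebra.
From mathcomp Require Import interval_inference reals convex mpoly.
From mathcomp Require Import polyrcf.
From mathcomp Require Import ring ssrZ.

(** Write [p] for the octic and [H] for its Hessian.

    Convexity.  A polynomial whose Hessian is positive semidefinite at every
    point is convex: restricted to a segment it is a univariate polynomial
    with nonnegative second derivative ([psd_hessian_convex]).  The form
    [d^T H(x) d] is not a sum of squares in [(x, d)], but its product with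
    [x1^2 + x3^2] is one: it equals [m^T G m], where [m] lists thirty
    monomials of degree 5 in [(x, d)] that are linear in [d], and [G] is a
    positive definite integer matrix.  The octic is even in each variable, so
    [G] splits into four blocks, one for each parity class of monomials.
    Positive definiteness of the blocks is decided by exact fraction-free
    elimination ([pivots_pos_qform_ge0]).  Where [x1 = x3 = 0] the multiplier
    vanishes, but there [H] is diagonal with nonnegative entries.

    Failure of sos-convexity.  If [H = M^T M], the corner entry
    [h = H 1 1], a ternary sextic, is the sum of the squares of the entries in
    the first column of [M].  Leading terms of squares cannot cancel over an
    ordered field, so these entries have degree at most 3 ([sos_msize]).  Put
    [x3 = 1].  The linear functional [separator] takes nonnegative values on
    the squares of bivariate polynomials of degree at most 3
    ([separator_sqr_ge0]), and it takes the value -250 on [h]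
    ([separator_octic_h11]), a contradiction. *)

Set Implicit Arguments.
Unset Strict Implicit.
Unset Printing Implicit Defensive.

Import Order.TTheory GRing.Theory Num.Theory.

Local Open Scope ring_scope.

(** * Positive semidefiniteness by exact elimination *)

(** Matrices are lists of rows, so that the elimination can be run by the
    kernel and the quadratic forms unfold to explicit polynomials. *)
Fixpoint dot (T : comNzRingType) (u v : seq T) : T :=
  if u is a :: u' then if v is b :: v' then a * b + dot u' v' else 0 else 0.

Definition qform (T : comNzRingType) (M : seq (seq T)) (v : seq T) : T :=
  dot v [seq dot r v | r <- M].

Definition schur_row (T : comNzRingType) (a : T) (u r : seq T) : seq T :=
  [seq a * p.1 - head 0 r * p.2 | p <- zip (behead r) u].

(** Symmetric Gaussian elimination without division: the Schur complement of
    the pivot is scaled by the pivot, which keeps the entries integral. *)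
Fixpoint pivots_pos (T : realDomainType) (n : nat) (M : seq (seq T)) : bool :=
  if n is n'.+1 then
    if M is (a :: u) :: M' then
      [&& 0 < a, [seq head 0 r | r <- M'] == u,
          all (fun r => size (behead r) == size u) M'
        & pivots_pos n' [seq schur_row a u r | r <- M']]
    else M == [::]
  else M == [::].

Section QuadraticForm.
Variable T : comNzRingType.
Implicit Types (u v w r : seq T) (M : seq (seq T)).

Lemma dotC u v : dot u v = dot v u.
Proof. by elim: u v => [|a u IHu] [|b v] //=; rewrite IHu mulrC. Qed.

Lemma dot_schur_row a u r w : size (behead r) = size u ->
  dot (schur_row a u r) w = a * dot (behead r) w - head 0 r * dot u w.
Proof.
rewrite /schur_row; move: (head 0 r) (behead r) => b t.
elim: t u w => [|c t IHt] [|d u] [|x w] //= => [_|_|_|[Etu]];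
  try by rewrite !mulr0 subr0.
by rewrite IHt //; ring.
Qed.

Lemma dot_rows_cons M x v w :
  dot w [seq dot r (x :: v) | r <- M] =
  x * dot w [seq head 0 r | r <- M] + dot w [seq dot (behead r) v | r <- M].
Proof.
elim: M w => [|r M IHM] [|y w] /=; rewrite ?mulr0 ?addr0 // IHM.
by case: r => [|c r] /=; ring.
Qed.

Lemma dot_rows_schur a u M v w :
    all (fun r => size (behead r) == size u) M ->
  dot w [seq dot r v | r <- [seq schur_row a u r | r <- M]] =
  a * dot w [seq dot (behead r) v | r <- M]
    - dot w [seq head 0 r | r <- M] * dot u v.
Proof.
elim: M w => [|r M IHM] [|y w] //=; try by rewrite mulr0 mul0r subr0.
by case/andP=> /eqP Er EM; rewrite IHM // dot_schur_row //; ring.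
Qed.

End QuadraticForm.

Section Pivots.
Variables (T R : realDomainType) (f : {rmorphism T -> R}).

Lemma map_schur_row (a : T) (u r : seq T) :
  map f (schur_row a u r) = schur_row (f a) (map f u) (map f r).
Proof.
rewrite /schur_row behead_map; have -> : head 0 (map f r) = f (head 0 r).
  by case: r => //=; rewrite rmorph0.
elim: (behead r) u => [|c t IHt] [|d u] //=.
by rewrite IHt rmorphB !rmorphM.
Qed.

(** Completing the square: with pivot [a], first row [a :: u] and lower right
    block [Q], [a * qform M (x :: w)] equals
    [(a x + u.w)^2 + (a * qform Q w - (u.w)^2)], and the second summand is
    the quadratic form of the scaled Schur complement.  The elimination runs
    over [T] and the conclusion is over [R], since the ring one computes in
    is not the ring of the vectors. *)
Lemma pivots_pos_qform_ge0 (f_gt0 : forall a, 0 < a -> 0 < f a) n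
    (M : seq (seq T)) (v : seq R) :
  pivots_pos n M -> 0 <= qform [seq map f r | r <- M] v.
Proof.
elim: n M v => [|n IHn] [|[|a u] M'] [|x w] //=.
case/and4P=> [a_gt0 /eqP Eu Es /IHn IH].
rewrite -(pmulr_rge0 _ (f_gt0 _ a_gt0)) /qform /=.
have EM : [seq map f r | r <- [seq schur_row a u r | r <- M']] =
          [seq schur_row (f a) (map f u) r | r <- [seq map f r | r <- M']].
  by rewrite -!map_comp; apply: eq_map => r; apply: map_schur_row.
have := IH w; rewrite /qform EM dot_rows_schur; last first.
  rewrite all_map; apply: sub_all Es => r /=.
  by rewrite behead_map !size_map.
rewrite dot_rows_cons.
have -> : [seq head 0 r | r <- [seq map f r | r <- M']] = map f u.
  rewrite -Eu -!map_comp; apply: eq_map => -[|b r] //=.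
  by rewrite rmorph0.
rewrite (dotC w (map f u)); set D := dot w _; set e := dot (map f u) w => IHw.
have -> : f a * (x * (f a * x + e) + (x * e + D)) =
          (f a * x + e) ^+ 2 + (f a * D - e * e) by ring.
by rewrite addr_ge0 ?sqr_ge0.
Qed.

End Pivots.

(** [int] counts in unary, hence the passage to binary integers: the pivots
    of one matrix below have more than two thousand digits. *)
Definition pivots_posZ (M : seq (seq int)) : bool :=
  pivots_pos (size M) [seq map Z_of_int r | r <- M].

Lemma pivots_posZ_qform_ge0 (R : realDomainType) (M : seq (seq int))
    (v : seq R) :
  pivots_posZ M -> 0 <= qform [seq map intr r | r <- M] v.
Proof.
pose f : {rmorphism BinNums.Z -> R} := (intr \o int_of_Z)%FUN.
have f_gt0 a : 0 < a -> 0 < f a.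
  case: a => //= p _; rewrite ltr0z ltz_nat.
  exact/ssrnat.ltP/Pnat.Pos2Nat.is_pos.
move=> /(pivots_pos_qform_ge0 f_gt0 v); congr (_ <= qform _ v).
rewrite -map_comp; apply: eq_map => r /=; rewrite -map_comp.
by apply: eq_map => z /=; rewrite Z_of_intK.
Qed.

(** * Convexity from the Hessian *)

Lemma mderivXU (R : comNzRingType) n (i j : 'I_n) :
  ('X_j : {mpoly R[n]})^`M(i) = (j == i)%:R.
Proof.
rewrite mderivX mnm1E; case: eqP => [->|_]; last by rewrite scale0r.
have -> : (U_(i) - U_(i) = 0)%MM by apply/mnmP => k; rewrite mnmBE subnn mnm0E.
by rewrite scale1r mpolyX0.
Qed.

Section LinePoly.
Variables (R : comNzRingType) (n : nat) (x d : 'I_n -> R).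
Implicit Types p q : {mpoly R[n]}.

(** The restriction of [p] to the line [t |-> x + t d], as a polynomial in
    [t]; its derivatives are then algebraic. *)
Definition line_poly p : {poly R} :=
  mmap polyC (fun i => (x i)%:P + (d i)%:P * 'X) p.

HB.instance Definition _ := GRing.RMorphism.copy line_poly
  (mmap polyC (fun i => (x i)%:P + (d i)%:P * 'X)).

Lemma line_polyC c : line_poly c%:MP = c%:P.
Proof. exact: mmapC. Qed.

Lemma line_polyXU i : line_poly 'X_i = (x i)%:P + (d i)%:P * 'X.
Proof. by rewrite /line_poly mmapX mmap1U. Qed.

Lemma horner_line_poly p t :
  (line_poly p).[t] = p.@[fun i => x i + t * d i].
Proof.
rewrite [RHS]mevalE [line_poly p]/mmap horner_sum; apply: eq_bigr => m _.
rewrite hornerM hornerC horner_prod; congr (_ * _); apply: eq_bigr => i _.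
by rewrite horner_exp !hornerE [d i * t]mulrC.
Qed.

Definition has_chain_rule p :=
  (line_poly p)^`() = \sum_i (d i)%:P * line_poly (p^`M(i)).

Lemma has_chain_ruleC c : has_chain_rule c%:MP.
Proof.
rewrite /has_chain_rule line_polyC derivC big1 // => i _.
by rewrite mderivC rmorph0 mulr0.
Qed.

Lemma has_chain_ruleX j : has_chain_rule 'X_j.
Proof.
rewrite /has_chain_rule line_polyXU derivD derivC derivM derivC derivX.
rewrite (bigD1 j) //= mderivXU eqxx rmorph1 big1 => [|i ne_ij].
  by rewrite mul0r !add0r addr0.
by rewrite mderivXU eq_sym (negPf ne_ij) rmorph0 mulr0.
Qed.

Lemma has_chain_ruleD p q :
  has_chain_rule p -> has_chain_rule q -> has_chain_rule (p + q).
Proof.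
rewrite /has_chain_rule => Ep Eq; rewrite rmorphD derivD Ep Eq -big_split.
by apply: eq_bigr => i _; rewrite mderivD rmorphD mulrDr.
Qed.

Lemma has_chain_ruleM p q :
  has_chain_rule p -> has_chain_rule q -> has_chain_rule (p * q).
Proof.
rewrite /has_chain_rule => Ep Eq.
rewrite rmorphM derivM Ep Eq mulr_suml mulr_sumr -big_split.
apply: eq_bigr => i _; rewrite mderivM rmorphD !rmorphM.
by rewrite /= mulrDr !mulrA [line_poly p * _]mulrC.
Qed.

(** Both sides of the chain rule are derivations along the ring morphism
    [line_poly], so it is enough that they agree on constants and variables. *)
Lemma deriv_line_poly p : has_chain_rule p.
Proof.
elim/mpolyind: p => [|c m p _ _ IHp]; first exact: (has_chain_ruleC 0).
apply: has_chain_ruleD => //; rewrite -mul_mpolyC.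
apply: has_chain_ruleM; first exact: has_chain_ruleC.
rewrite mpolyXE_id; elim/big_ind: _ => [||i _].
- exact: (has_chain_ruleC 1).
- exact: has_chain_ruleM.
elim: (m i) => [|k IHk]; first exact: (has_chain_ruleC 1).
by rewrite exprS; apply: has_chain_ruleM => //; apply: has_chain_ruleX.
Qed.

Lemma horner_deriv2_line_poly p t :
  (line_poly p)^`()^`().[t] =
  \sum_i \sum_j d i * d j * (hessian p i j).@[fun k => x k + t * d k].
Proof.
rewrite deriv_line_poly raddf_sum /= horner_sum exchange_big /=.
apply: eq_bigr => j _; rewrite derivM derivC mul0r add0r deriv_line_poly.
rewrite mulr_sumr horner_sum; apply: eq_bigr => i _.
by rewrite !hornerM !hornerC horner_line_poly mxE; ring.
Qed.

End LinePoly.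

(** The mean value theorem gives slopes [g'(a)] on [[0, t]] and [g'(b)] on
    [[t, 1]] with [a < b]; applied once more, to [g'], it compares them. *)
Lemma poly_convex (R : rcfType) (g : {poly R}) (t : R) :
    (forall s, 0 <= g^`()^`().[s]) -> 0 <= t <= 1 ->
  g.[t] <= t * g.[1] + (1 - t) * g.[0].
Proof.
move=> g2_ge0 /andP[t_ge0 t_le1].
have [->|t_neq0] := eqVneq t 0; first by rewrite mul0r add0r subr0 mul1r.
have [->|t_neq1] := eqVneq t 1; first by rewrite subrr mul0r addr0 mul1r.
have t_gt0 : 0 < t by rewrite lt_def t_neq0.
have t_lt1 : t < 1 by rewrite lt_neqAle t_neq1.
have [a /itvP a_in Ea] := poly_mvt g t_gt0.
have [b /itvP b_in Eb] := poly_mvt g t_lt1.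
have lt_ab : a < b by apply: (@lt_trans _ _ t); rewrite ?a_in ?b_in.
have [c _ Ec] := poly_mvt g^`() lt_ab.
have : 0 <= g^`()^`().[c] * (b - a).
  by rewrite mulr_ge0 ?g2_ge0 // subr_ge0 ltW.
rewrite -Ec => slope_le; rewrite -subr_ge0.
have -> : t * g.[1] + (1 - t) * g.[0] - g.[t] =
    t * (g.[1] - g.[t]) - (1 - t) * (g.[t] - g.[0]) by ring.
rewrite Ea Eb.
have -> : t * (g^`().[b] * (1 - t)) - (1 - t) * (g^`().[a] * (t - 0)) =
    t * (1 - t) * (g^`().[b] - g^`().[a]) by ring.
by rewrite mulr_ge0 // mulr_ge0 // subr_ge0.
Qed.

(** Convexity only concerns segments, and the second derivative of [p] along
    a line is the value of the Hessian form on the direction of the line. *)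
Lemma psd_hessian_convex (R : realType) (n : nat) (p : {mpoly R[n]}) :
    (forall v d : 'I_n -> R,
       0 <= \sum_i \sum_j d i * d j * (hessian p i j).@[v]) ->
  convex_poly p.
Proof.
move=> psd t a b _ _.
rewrite convRE; pose g := line_poly (b 0) (fun i => a 0 i - b 0 i) p.
have Eg s : g.[s] = p.@[fun i => b 0 i + s * (a 0 i - b 0 i)].
  exact: horner_line_poly.
have -> : p.@[(conv t a b) 0] = g.[t%:inum].
  by rewrite Eg; apply: meval_eq => i; rewrite !mxE /unstable.onem; ring.
have -> : p.@[a 0] = g.[1] by rewrite Eg; apply: meval_eq => i; ring.
have -> : p.@[b 0] = g.[0] by rewrite Eg; apply: meval_eq => i; ring.
apply: poly_convex => [s|]; first by rewrite horner_deriv2_line_poly.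
by rewrite ge0 le1.
Qed.

(** * Sums of squares of polynomials *)

(** The largest leading monomial [m] among the summands survives in the sum:
    the coefficient of [2 m] there is a sum of squares, one of them nonzero. *)
Lemma sos_msize (R : realDomainType) n s (q : 'I_s -> {mpoly R[n]})
    (h : {mpoly R[n]}) k :
  h = \sum_i q i * q i -> ((msize (q k)).*2 <= (msize h).+1)%N.
Proof.
move=> Eh; have [->|qk_neq0] := eqVneq (q k) 0; first by rewrite msize0.
have [j qj_neq0 j_max] := @Order.TotalTheory.arg_maxP _ _ _ k
  (fun i => q i != 0) (fun i => mlead (q i)) qk_neq0.
have le_j i : (mlead (q i) <= mlead (q j))%O.
  by have [->|/j_max//] := eqVneq (q i) 0; rewrite mlead0 le0x.
have h_lead : h@_(mlead (q j) + mlead (q j)) != 0.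
  rewrite Eh raddf_sum /= (eq_bigr (fun i => (q i)@_(mlead (q j)) ^+ 2));
    last by move=> i _; rewrite mleadcMW.
  rewrite psumr_eq0 => [|i _]; last exact: sqr_ge0.
  apply/allPn; exists j; first by rewrite mem_index_enum.
  by rewrite /= sqrf_eq0 mleadc_eq0.
have : (mdeg (mlead (q j)) + mdeg (mlead (q j)) < msize h)%N.
  by rewrite -mdegD; apply: msize_mdeg_lt; rewrite mcoeff_msupp.
have := lemc_mdeg (le_j k); rewrite -(mlead_deg qk_neq0) doubleS -addnn.
by move=> le_kj lt_jh; rewrite !ltnS (leq_ltn_trans _ lt_jh) // leq_add.
Qed.

Section Dehomogenization.
Variable R : comNzRingType.
Implicit Types q : {mpoly R[3]}.

Definition dehomog_var (i : 'I_3) : {poly {poly R}} :=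
  nth 1 [:: 'X%:P; 'X] i.

(** Setting the third variable to 1.  The outer indeterminate of
    [{poly {poly R}}] is the second variable, so that [f`_j`_i] is the
    coefficient of [x^i y^j]. *)
Definition dehomog : {mpoly R[3]} -> {poly {poly R}} :=
  mmap (polyC \o polyC) dehomog_var.

HB.instance Definition _ := GRing.RMorphism.copy dehomog
  (mmap (polyC \o polyC) dehomog_var).

Lemma dehomogX i : dehomog 'X_i = dehomog_var i.
Proof. by rewrite /dehomog mmapX mmap1U. Qed.

Lemma coef_monomial2 (c : R) k l i j :
  (c%:P%:P * 'X%:P ^+ k * 'X ^+ l : {poly {poly R}})`_j`_i =
  c * ((i == k) && (j == l))%:R.
Proof.
rewrite -polyC_exp -polyCM coefCM coefXn; case: eqP => _; last first.
  by rewrite andbF !mulr0 coef0.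
by rewrite mulr1 andbT coefCM coefXn.
Qed.

Lemma dehomog_coef_eq0 q i j : (msize q <= i + j)%N -> (dehomog q)`_j`_i = 0.
Proof.
move=> q_le; rewrite [dehomog q]/mmap !coef_sum big1_seq // => m /= m_in.
rewrite /mmap1 !big_ord_recl big_ord0 /dehomog_var /= expr1n !mulr1 mulrA.
rewrite coef_monomial2.
case: andP => [[/eqP Ei /eqP Ej]|_]; last by rewrite mulr0.
have := msize_mdeg_lt m_in; rewrite ltnNge (leq_trans q_le) // Ei Ej.
by rewrite mdegE !big_ord_recl big_ord0 /= addnA leq_addr.
Qed.

End Dehomogenization.

(** * The Hessian of the octic *)

(** The entries are polymorphic because they are evaluated at variables, at
    elements of the base ring and at bivariate polynomials. *)
Definition octic_h11 (T : comNzRingType) (x y z : T) : T :=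
  1792%:R * x ^+ 6 + 3540%:R * x ^+ 4 * y ^+ 2 + 1200%:R * x ^+ 4 * z ^+ 2
  + 300%:R * x ^+ 2 * y ^+ 4 - 516%:R * x ^+ 2 * y ^+ 2 * z ^+ 2
  - 420%:R * x ^+ 2 * z ^+ 4 + 6%:R * y ^+ 4 * z ^+ 2
  - 32%:R * y ^+ 2 * z ^+ 4 + 48%:R * z ^+ 6.

Definition octic_h12 (T : comNzRingType) (x y z : T) : T :=
  1416%:R * x ^+ 5 * y + 400%:R * x ^+ 3 * y ^+ 3
  - 344%:R * x ^+ 3 * y * z ^+ 2 + 24%:R * x * y ^+ 3 * z ^+ 2
  - 64%:R * x * y * z ^+ 4.

Definition octic_h13 (T : comNzRingType) (x y z : T) : T :=
  480%:R * x ^+ 5 * z - 344%:R * x ^+ 3 * y ^+ 2 * z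
  - 560%:R * x ^+ 3 * z ^+ 3 + 12%:R * x * y ^+ 4 * z
  - 128%:R * x * y ^+ 2 * z ^+ 3 + 288%:R * x * z ^+ 5.

Definition octic_h22 (T : comNzRingType) (x y z : T) : T :=
  236%:R * x ^+ 6 + 300%:R * x ^+ 4 * y ^+ 2 - 86%:R * x ^+ 4 * z ^+ 2
  + 36%:R * x ^+ 2 * y ^+ 2 * z ^+ 2 - 32%:R * x ^+ 2 * z ^+ 4
  + 896%:R * y ^+ 6 + 1320%:R * y ^+ 4 * z ^+ 2 + 840%:R * y ^+ 2 * z ^+ 4
  + 120%:R * z ^+ 6.

Definition octic_h23 (T : comNzRingType) (x y z : T) : T :=
  - 172%:R * x ^+ 4 * y * z + 24%:R * x ^+ 2 * y ^+ 3 * z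
  - 128%:R * x ^+ 2 * y * z ^+ 3 + 528%:R * y ^+ 5 * z
  + 1120%:R * y ^+ 3 * z ^+ 3 + 720%:R * y * z ^+ 5.

Definition octic_h33 (T : comNzRingType) (x y z : T) : T :=
  80%:R * x ^+ 6 - 86%:R * x ^+ 4 * y ^+ 2 - 420%:R * x ^+ 4 * z ^+ 2
  + 6%:R * x ^+ 2 * y ^+ 4 - 192%:R * x ^+ 2 * y ^+ 2 * z ^+ 2
  + 720%:R * x ^+ 2 * z ^+ 4 + 88%:R * y ^+ 6 + 840%:R * y ^+ 4 * z ^+ 2
  + 1800%:R * y ^+ 2 * z ^+ 4 + 1680%:R * z ^+ 6.

Lemma rmorph_octic_h11 (S T : comNzRingType) (f : {rmorphism S -> T}) x y z :
  f (octic_h11 x y z) = octic_h11 (f x) (f y) (f z).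
Proof. by rewrite /octic_h11; ring. Qed.

Lemma big_ord3 (V : nmodType) (F : 'I_3 -> V) :
  \sum_i F i = F (inord 0) + F (inord 1) + F (inord 2).
Proof.
rewrite !big_ord_recl big_ord0 addr0 addrA.
by congr (F _ + F _ + F _); apply: val_inj; rewrite /= inordK.
Qed.

Lemma eq_inord3 a b : (a < 3)%N -> (b < 3)%N ->
  (inord a == inord b :> 'I_3) = (a == b).
Proof. by move=> lt_a lt_b; rewrite -val_eqE /= !inordK. Qed.

Lemma mderivXn (R : comNzRingType) n (p : {mpoly R[n]}) i k :
  (p ^+ k)^`M(i) = k%:R * p ^+ k.-1 * p^`M(i).
Proof.
case: k => [|k]; first by rewrite expr0 mulr0n !mul0r -mpolyC1 mderivC.
elim: k => [|k IHk]; first by rewrite !expr1 !mul1r.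
by rewrite exprS mderivM {}IHk /= exprS; ring.
Qed.

Lemma mderiv_nat (R : comNzRingType) n k i :
  (k%:R : {mpoly R[n]})^`M(i) = 0.
Proof. by rewrite -mpolyC_nat mderivC. Qed.

Definition mderivE :=
  (mderivD, mderivN, mderivM, mderivXn, mderiv_nat, mderivXU).

Section OcticHessian.
Variable R : comNzRingType.

Local Notation x1 := ('X_(inord 0) : {mpoly R[3]}).
Local Notation x2 := ('X_(inord 1) : {mpoly R[3]}).
Local Notation x3 := ('X_(inord 2) : {mpoly R[3]}).

Lemma mderiv_octic1 : (octic_form R)^`M(inord 0) =
  256%:R * x1 ^+ 7 + 708%:R * x1 ^+ 5 * x2 ^+ 2 + 240%:R * x1 ^+ 5 * x3 ^+ 2
  + 100%:R * x1 ^+ 3 * x2 ^+ 4 - 172%:R * x1 ^+ 3 * x2 ^+ 2 * x3 ^+ 2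
  - 140%:R * x1 ^+ 3 * x3 ^+ 4 + 6%:R * x1 * x2 ^+ 4 * x3 ^+ 2
  - 32%:R * x1 * x2 ^+ 2 * x3 ^+ 4 + 48%:R * x1 * x3 ^+ 6.
Proof. by rewrite /octic_form !mderivE !eq_inord3 //=; ring. Qed.

Lemma mderiv_octic2 : (octic_form R)^`M(inord 1) =
  236%:R * x1 ^+ 6 * x2 + 100%:R * x1 ^+ 4 * x2 ^+ 3
  - 86%:R * x1 ^+ 4 * x2 * x3 ^+ 2 + 12%:R * x1 ^+ 2 * x2 ^+ 3 * x3 ^+ 2
  - 32%:R * x1 ^+ 2 * x2 * x3 ^+ 4 + 128%:R * x2 ^+ 7
  + 264%:R * x2 ^+ 5 * x3 ^+ 2 + 280%:R * x2 ^+ 3 * x3 ^+ 4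
  + 120%:R * x2 * x3 ^+ 6.
Proof. by rewrite /octic_form !mderivE !eq_inord3 //=; ring. Qed.

Lemma mderiv_octic3 : (octic_form R)^`M(inord 2) =
  80%:R * x1 ^+ 6 * x3 - 86%:R * x1 ^+ 4 * x2 ^+ 2 * x3
  - 140%:R * x1 ^+ 4 * x3 ^+ 3 + 6%:R * x1 ^+ 2 * x2 ^+ 4 * x3
  - 64%:R * x1 ^+ 2 * x2 ^+ 2 * x3 ^+ 3 + 144%:R * x1 ^+ 2 * x3 ^+ 5
  + 88%:R * x2 ^+ 6 * x3 + 280%:R * x2 ^+ 4 * x3 ^+ 3
  + 360%:R * x2 ^+ 2 * x3 ^+ 5 + 240%:R * x3 ^+ 7.
Proof. by rewrite /octic_form !mderivE !eq_inord3 //=; ring. Qed.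

Lemma mderiv2_octic11 :
  (octic_form R)^`M(inord 0)^`M(inord 0) = octic_h11 x1 x2 x3.
Proof.
by rewrite mderiv_octic1 /octic_h11 !mderivE !eq_inord3 //=; ring.
Qed.

Lemma mderiv2_octic12 :
  (octic_form R)^`M(inord 1)^`M(inord 0) = octic_h12 x1 x2 x3.
Proof.
by rewrite mderiv_octic2 /octic_h12 !mderivE !eq_inord3 //=; ring.
Qed.

Lemma mderiv2_octic13 :
  (octic_form R)^`M(inord 2)^`M(inord 0) = octic_h13 x1 x2 x3.
Proof.
by rewrite mderiv_octic3 /octic_h13 !mderivE !eq_inord3 //=; ring.
Qed.

Lemma mderiv2_octic22 :
  (octic_form R)^`M(inord 1)^`M(inord 1) = octic_h22 x1 x2 x3.
Proof.
by rewrite mderiv_octic2 /octic_h22 !mderivE !eq_inord3 //=; ring.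
Qed.

Lemma mderiv2_octic23 :
  (octic_form R)^`M(inord 2)^`M(inord 1) = octic_h23 x1 x2 x3.
Proof.
by rewrite mderiv_octic3 /octic_h23 !mderivE !eq_inord3 //=; ring.
Qed.

Lemma mderiv2_octic33 :
  (octic_form R)^`M(inord 2)^`M(inord 2) = octic_h33 x1 x2 x3.
Proof.
by rewrite mderiv_octic3 /octic_h33 !mderivE !eq_inord3 //=; ring.
Qed.

Lemma octic_hessian_form (v d : 'I_3 -> R) :
  let x := v (inord 0) in let y := v (inord 1) in let z := v (inord 2) in
  let a := d (inord 0) in let b := d (inord 1) in let c := d (inord 2) in
  \sum_i \sum_j d i * d j * (hessian (octic_form R) i j).@[v] =
  a ^+ 2 * octic_h11 x y z +
  2%:R * a * b * octic_h12 x y z +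
  2%:R * a * c * octic_h13 x y z +
  b ^+ 2 * octic_h22 x y z +
  2%:R * b * c * octic_h23 x y z +
  c ^+ 2 * octic_h33 x y z.
Proof.
rewrite /= !big_ord3 !mxE (mderiv_comm (inord 0) (inord 1)).
rewrite (mderiv_comm (inord 0) (inord 2)) (mderiv_comm (inord 1) (inord 2)).
rewrite mderiv2_octic11 mderiv2_octic12 mderiv2_octic13.
rewrite mderiv2_octic22 mderiv2_octic23 mderiv2_octic33.
(* Evaluation is pushed to the variables by the morphism laws inside ring. *)
rewrite -!(mevalXU v) /octic_h11 /octic_h12 /octic_h13 /octic_h22 /octic_h23.
by rewrite /octic_h33; ring.
Qed.

End OcticHessian.

(** * Convexity of the octic *)

(* Without this, simplification unfolds numerals above 5000 to terms that the
   ring tactic does not read as constants. *)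
Local Arguments Nat.of_num_uint : simpl never.

(** The blocks of the Gram matrix of [(x^2 + z^2) d^T H(x, y, z) d].  Among
    the many Gram matrices of this form, these were found by semidefinite
    programming: monomials were discarded as long as a positive definite
    solution remained, and the analytic centre of the remaining solutions was
    rounded to integers.  The digits in a name are the indices [i] for which
    the monomials of the block have odd total degree in [x_i] and [d_i]. *)
Definition gram1 : seq (seq int) := [::
  [::    48;   -16;  -392;   -94;   159;    23;    37;    53;    -5];
  [::   -16;     6;   125;    28;   -43;    -5;   -11;   -18;     4];
  [::  -392;   125;  3324;   748; -1411;  -316;  -340;  -518;    50];
  [::   -94;    28;   748;   300;  -495;     0;   -94;    30;   -66];
  [::   159;   -43; -1411;  -495;  1792;   494;   411;   -62;   281];
  [::    23;    -5;  -316;     0;   494;   896;     0;   421;    22];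
  [::    37;   -11;  -340;   -94;   411;     0;   300;   -54;   -24];
  [::    53;   -18;  -518;    30;   -62;   421;   -54;   674;  -167];
  [::    -5;     4;    50;   -66;   281;    22;   -24;  -167;   146]]%Z.

Definition gram123 : seq (seq int) := [::
  [:: 1236; -585;  -68;  167];
  [:: -585;  410;  101; -149];
  [::  -68;  101;   88;  -60];
  [::  167; -149;  -60;   70]]%Z.

Definition gram3 : seq (seq int) := [::
  [::   412;  -313; -1431;   -91;   -34;  -518;   288;    22;   164;    90;   -81];
  [::  -313;   250;  1043;    35;     5;   406;  -203;    27;  -134;   -76;    61];
  [:: -1431;  1043;  5814;   631;   345;  1952;  -431;    86;   -49;  -277;   199];
  [::   -91;    35;   631;   840;   660;   438;   720;   385;   590;   194;  -174];
  [::   -34;     5;   345;   660;   896;    42;   755;   528;   638;   175;  -168];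
  [::  -518;   406;  1952;   438;    42;  1506;     2;   294;  -126;   -47;     1];
  [::   288;  -203;  -431;   720;   755;     2;  1680;   900;  1200;   259;  -341];
  [::    22;    27;    86;   385;   528;   294;   900;   840;   545;    86;  -174];
  [::   164;  -134;   -49;   590;   638;  -126;  1200;   545;   982;   202;  -243];
  [::    90;   -76;  -277;   194;   175;   -47;   259;    86;   202;   126;   -78];
  [::   -81;    61;   199;  -174;  -168;     1;  -341;  -174;  -243;   -78;    80]]%Z.

Definition gram2 : seq (seq int) := [::
  [::   16; -236;   27;   27;  -53;    3];
  [:: -236; 4530; -585; -487; 1005;   58];
  [::   27; -585;  120;   44; -131;  -20];
  [::   27; -487;   44;  144; -130;   18];
  [::  -53; 1005; -131; -130;  236;    3];
  [::    3;   58;  -20;   18;    3;   88]]%Z.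

Section OcticPsd.
Variable R : realDomainType.

Lemma octic_hessian_psd (v d : 'I_3 -> R) :
  0 <= \sum_i \sum_j d i * d j * (hessian (octic_form R) i j).@[v].
Proof.
rewrite octic_hessian_form /=.
move: (v (inord 0)) (v (inord 1)) (v (inord 2)) => x y z.
move: (d (inord 0)) (d (inord 1)) (d (inord 2)) => a b c.
rewrite /octic_h11 /octic_h12 /octic_h13 /octic_h22 /octic_h23 /octic_h33.
set H := (X in 0 <= X).
have [xz_gt0|] := ltP 0 (x ^+ 2 + z ^+ 2); last first.
  rewrite le_eqVlt ltNge addr_ge0 ?sqr_ge0 // orbF paddr_eq0 ?sqr_ge0 //.
  rewrite !sqrf_eq0 => /andP[/eqP x0 /eqP z0].
  have -> : H = (y ^+ 3) ^+ 2 * (896%:R * b ^+ 2 + 88%:R * c ^+ 2).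
    by rewrite /H x0 z0; ring.
  apply: mulr_ge0; first exact: sqr_ge0.
  by apply: addr_ge0; apply: mulr_ge0; rewrite ?ler0n ?sqr_ge0.
rewrite -(pmulr_rge0 H xz_gt0).
pose m1 := [:: z ^+ 4 * a; y ^+ 2 * z ^+ 2 * a; x ^+ 2 * z ^+ 2 * a;
  x ^+ 2 * y ^+ 2 * a; x ^+ 4 * a; x * y ^+ 3 * b; x ^+ 3 * y * b;
  x * y ^+ 2 * z * c; x ^+ 3 * z * c].
pose m123 := [:: x * y ^+ 2 * z * b; x ^+ 3 * z * b; x * y ^+ 3 * c;
  x ^+ 3 * y * c].
pose m3 := [:: x * z ^+ 3 * a; x * y ^+ 2 * z * a; x ^+ 3 * z * a;
  y * z ^+ 3 * b; y ^+ 3 * z * b; x ^+ 2 * y * z * b; z ^+ 4 * c;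
  y ^+ 2 * z ^+ 2 * c; x ^+ 2 * z ^+ 2 * c; x ^+ 2 * y ^+ 2 * c; x ^+ 4 * c].
pose m2 := [:: x * y * z ^+ 2 * a; x ^+ 3 * y * a; z ^+ 4 * b;
  x ^+ 2 * z ^+ 2 * b; x ^+ 4 * b; y ^+ 3 * z * c].
have -> : (x ^+ 2 + z ^+ 2) * H =
    qform [seq map intr r | r <- gram1] m1
    + qform [seq map intr r | r <- gram2] m2
    + qform [seq map intr r | r <- gram3] m3
    + qform [seq map intr r | r <- gram123] m123.
  by rewrite /qform /H /=; ring.
apply: addr_ge0; first apply: addr_ge0; first apply: addr_ge0;
  by apply: pivots_posZ_qform_ge0; vm_compute.
Qed.

End OcticPsd.

(** * A functional that separates the corner entry from the sums of squares *)

Section Separator.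
Variable R : realDomainType.
Implicit Types f g : {poly {poly R}}.

(** A point in the interior of the dual of the cone of sums of squares of
    cubics, chosen negative on [octic_h11] and rounded to small integers.
    The weight of [y^6] can be taken large at no cost, because [octic_h11] does
    not contain this monomial; it makes the block of [y^3] positive. *)
Definition separator f : R :=
  2%:R * f`_0`_6 + 3%:R * f`_2`_4 + 7%:R * f`_0`_4 + 53%:R * f`_4`_2
  + 59%:R * f`_2`_2 + 74%:R * f`_0`_2 + 10904%:R * f`_6`_0
  + 2259%:R * f`_4`_0 + 1332%:R * f`_2`_0 + 1080%:R * f`_0`_0.

Lemma separatorD f g : separator (f + g) = separator f + separator g.
Proof. by rewrite /separator !coefD; ring. Qed.

Lemma separator_sum s (F : 'I_s -> {poly {poly R}}) :
  separator (\sum_i F i) = \sum_i separator (F i).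
Proof.
elim/big_rec2: _ => [|i x y _ <-]; last by rewrite separatorD.
by rewrite /separator !coef0; ring.
Qed.

(** Only monomials that are even in [x] and in [y] have a weight, so the form
    [f |-> separator (f * f)] on cubics has a diagonal block for each parity
    class: [x^3, x y^2, x], then [y^3, x^2 y, y], then [1, x^2, y^2], and
    finally [x y]. *)
Lemma separator_sqr_ge0 f :
  (forall i j, (4 <= i + j)%N -> f`_j`_i = 0) -> 0 <= separator (f * f).
Proof.
move=> f_eq0; pose a i j := f`_j`_i.
(* The conditional lets evaluation discard all coefficients above degree 3. *)
have fE i j : f`_j`_i = if (i + j < 4)%N then a i j else 0.
  by case: ltnP => // /f_eq0.
have ffE i j : (f * f)`_j`_i =
    \sum_(l <- iota 0 j.+1) \sum_(k <- iota 0 i.+1)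
      (if (k + l < 4)%N then a k l else 0) *
      (if ((i - k) + (j - l) < 4)%N then a (i - k)%N (j - l)%N else 0).
  rewrite coefM coef_sum -[iota 0 j.+1]/(index_iota 0 j.+1) big_mkord.
  apply: eq_bigr => l _; rewrite coefM.
  rewrite -[iota 0 i.+1]/(index_iota 0 i.+1) big_mkord.
  by apply: eq_bigr => k _; rewrite !fE.
rewrite /separator !ffE; move: a {fE ffE f_eq0} => a.
pose gx := [:: [:: 2; 3; 7]; [:: 3; 53; 59]; [:: 7; 59; 74]]%Z.
pose gy := [:: [:: 10904; 53; 2259]; [:: 53; 3; 59]; [:: 2259; 59; 1332]]%Z.
pose g1 := [:: [:: 1080; 74; 1332]; [:: 74; 7; 59]; [:: 1332; 59; 2259]]%Z.
set S := (X in 0 <= X).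
have -> : S =
    qform [seq map intr r | r <- gx] [:: a 3 0; a 1 2; a 1 0]%N
    + qform [seq map intr r | r <- gy] [:: a 0 3; a 2 1; a 0 1]%N
    + qform [seq map intr r | r <- g1] [:: a 0 0; a 2 0; a 0 2]%N
    + 59%:R * a 1%N 1%N ^+ 2.
  by rewrite /S /qform /= !big_cons !big_nil /=; ring.
apply: addr_ge0; last by rewrite mulr_ge0 ?sqr_ge0 ?ler0n.
apply: addr_ge0; first apply: addr_ge0;
  by apply: pivots_posZ_qform_ge0; vm_compute.
Qed.

Lemma separator_monomial (c : R) k l :
  separator (c%:P%:P * 'X%:P ^+ k * 'X ^+ l) =
  c * let e (i j : nat) : R := ((i == k) && (j == l))%:R in
      2%:R * e 6 0 + 3%:R * e 4 2 + 7%:R * e 4 0 + 53%:R * e 2 4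
      + 59%:R * e 2 2 + 74%:R * e 2 0 + 10904%:R * e 0 6
      + 2259%:R * e 0 4 + 1332%:R * e 0 2 + 1080%:R * e 0 0.
Proof. by rewrite /separator !coef_monomial2 /=; ring. Qed.

Lemma separator_octic_h11 : separator (octic_h11 'X%:P 'X 1) = - 250%:R.
Proof.
have -> : octic_h11 'X%:P 'X 1 =
    1792%:R%:P%:P * 'X%:P ^+ 6 * 'X ^+ 0 + 3540%:R%:P%:P * 'X%:P ^+ 4 * 'X ^+ 2
    + 1200%:R%:P%:P * 'X%:P ^+ 4 * 'X ^+ 0 + 300%:R%:P%:P * 'X%:P ^+ 2 * 'X ^+ 4
    + (- 516%:R)%:P%:P * 'X%:P ^+ 2 * 'X ^+ 2
    + (- 420%:R)%:P%:P * 'X%:P ^+ 2 * 'X ^+ 0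
    + 6%:R%:P%:P * 'X%:P ^+ 0 * 'X ^+ 4
    + (- 32%:R)%:P%:P * 'X%:P ^+ 0 * 'X ^+ 2
    + 48%:R%:P%:P * 'X%:P ^+ 0 * 'X ^+ 0 :> {poly {poly R}}.
  by rewrite /octic_h11; ring.
by rewrite !separatorD !separator_monomial /=; ring.
Qed.

End Separator.

(** * The octic is convex but not sos-convex *)

Section Homogeneity.
Variables (R : comNzRingType) (n : nat).
Implicit Types (i j l : 'I_n) (c p q r e : nat).

Lemma dhomogX_exp i p : ('X_i : {mpoly R[n]}) ^+ p \is p.-homog.
Proof.
have Xi : ('X_i : {mpoly R[n]}) \is 1.-homog by rewrite dhomogX /= mdeg1.
by have := dhomogMn p Xi; rewrite mul1n.
Qed.

Lemma dhomog_monomial1 c i p e : p = e ->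
  c%:R * ('X_i : {mpoly R[n]}) ^+ p \is e.-homog.
Proof. by move=> <-; rewrite mulr_natl rpredMn ?dhomogX_exp. Qed.

Lemma dhomog_monomial2 c i j p q e : (p + q)%N = e ->
  c%:R * ('X_i : {mpoly R[n]}) ^+ p * 'X_j ^+ q \is e.-homog.
Proof.
by move=> <-; apply: dhomogM; rewrite ?dhomog_monomial1 ?dhomogX_exp.
Qed.

Lemma dhomog_monomial3 c i j l p q r e : (p + q + r)%N = e ->
  c%:R * ('X_i : {mpoly R[n]}) ^+ p * 'X_j ^+ q * 'X_l ^+ r \is e.-homog.
Proof.
by move=> <-; apply: dhomogM; rewrite ?dhomog_monomial2 ?dhomogX_exp.
Qed.

End Homogeneity.

Ltac solve_dhomog :=
  repeat apply: rpredD; rewrite ?dhomogN;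
  lazymatch goal with
  | |- is_true (_ * _ * _ * _ \in _) => exact: dhomog_monomial3
  | |- is_true (_ * _ * _ \in _) => exact: dhomog_monomial2
  | |- is_true (_ * _ \in _) => exact: dhomog_monomial1
  end.

Lemma octic_form_homog (R : comNzRingType) : octic_form R \is 8.-homog.
Proof. rewrite /octic_form /=; solve_dhomog. Qed.

Lemma msize_octic_h11 (R : comNzRingType) :
  (msize (octic_h11 'X_(inord 0) 'X_(inord 1) 'X_(inord 2) : {mpoly R[3]})
   <= 7)%N.
Proof.
set h := octic_h11 _ _ _; have /dhomogP h_homog : h \is 6.-homog.
  rewrite /h /octic_h11; solve_dhomog.
by rewrite msizeE; apply/bigmax_leqP_seq => m /h_homog /= ->.
Qed.

Lemma octic_form_convex (R : realType) : convex_poly (octic_form R).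
Proof. by apply: psd_hessian_convex => v d; apply: octic_hessian_psd. Qed.

Lemma octic_form_not_sos_convex (R : realDomainType) :
  ~ sos_convex (octic_form R).
Proof.
case=> _ [s [M /matrixP/(_ (inord 0) (inord 0))]].
rewrite !mxE mderiv2_octic11; under eq_bigr do rewrite mxE.
move=> EM.
have q_small k : (msize (M k (inord 0)) <= 4)%N.
  by rewrite -leq_double (leq_trans (sos_msize k EM)) // ltnS msize_octic_h11.
have := separator_octic_h11 R.
have -> : octic_h11 'X%:P 'X 1 =
    \sum_k dehomog (M k (inord 0)) * dehomog (M k (inord 0)).
  under eq_bigr do rewrite -rmorphM.
  rewrite -rmorph_sum -EM rmorph_octic_h11 /= !dehomogX /dehomog_var.
  by rewrite !inordK.
rewrite separator_sum => sep_neg.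
have : 0 <= - 250%:R :> R.
  rewrite -sep_neg sumr_ge0 // => k _; apply: separator_sqr_ge0 => i j le4.
  exact/dehomog_coef_eq0/(leq_trans (q_small k)).
by rewrite oppr_ge0 lern0.
Qed.

Theorem theorem3p2 (R : realType) :
  (exists (n : nat) (q : {mpoly R[n]}), convex_poly q /\ ~ sos_convex q) /\
  [/\ octic_form R \is 8.-homog,
      convex_poly (octic_form R)
    & ~ sos_convex (octic_form R)].
Proof.
have octic_convex := @octic_form_convex R.
have octic_not_sos := @octic_form_not_sos_convex R.
split; first by exists 3, (octic_form R).
by split=> //; apply: octic_form_homog.
Qed.
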